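(* Let $\delta > 0$ and let $V_1, V_2, \ldots, V_n \subset \mathbb{R}^d$ be a $(\delta,n)$-MR configuration, and let $V = V_1 \cup \cdots \cup V_n$. Then for any real $\epsilon$ with $0 < \epsilon < \delta$ we have $$\mathrm{adim}(V) \leq \frac{C}{\epsilon^2}\cdot\left(1 + \frac{1}{\delta - \epsilon}\right)^n,$$ where $C > 0$ is an absolute constant (independent of $n,\delta,\epsilon,d$ and the configuration).
   Context: A $(\delta,n)$-MR configuration is a family $V_1,\ldots,V_n$ of pairwise disjoint finite sets of points in $\mathbb{R}^d$, with $V = V_1\cup\cdots\cup V_n$, such that for each $i$ and each $v \in V_i$ there are at least $\delta|V_i|$ points $u \in V_i \setminus\{v\}$ for which the line through $v$ and $u$ contains a third point belonging to $V \setminus V_i$. By convention the sets are indexed so that $|V_1| \geq |V_2| \geq \cdots \geq |V_n|$. For a set $S \subset \mathbb{R}^d$, $\mathrm{adim}(S)$ denotes the dimension of the affine span of $S$ (the smallest affine subspace containing $S$). *)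

(* Defs.v *)
From HB Require Import structures.
From mathcomp Require Import all_boot all_order all_algebra finmap.
From mathcomp Require Import boolp classical_sets reals.

Set Implicit Arguments.
Unset Strict Implicit.
Unset Printing Implicit Defensive.

Import Order.TTheory GRing.Theory Num.Theory.

Local Open Scope classical_set_scope.
Local Open Scope ring_scope.

Section AffineGeometry.
Context {R : realType} {d : nat}.
Implicit Types (p u v : 'rV[R]_d) (U : {vspace 'rV[R]_d}) (S A : set 'rV[R]_d).

Definition translate p U : set 'rV[R]_d := [set p + u | u in [set` U]].

(* The empty set counts as an affine subspace, so that the span of the empty
   set is empty in every dimension, d = 0 included. *)
Definition is_affine_subspace A : Prop :=
  A = set0 \/ exists p U, A = translate p U.

Definition affine_span S : set 'rV[R]_d :=
  \bigcap_(A in [set A | is_affine_subspace A /\ S `<=` A]) A.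

(* The direction is unique when A is a nonempty affine subspace
   (direction_translate); it is set to 0 when A is empty. *)
Definition direction A : {vspace 'rV[R]_d} :=
  xget 0%VS [set U | exists p, A = translate p U].

(* With values in nat, the affine dimension of the empty set is 0. *)
Definition adim S : nat := \dim (direction (affine_span S)).

(* The affine line through v and u, for u != v. *)
Definition line v u : set 'rV[R]_d := [set v + t *: (u - v) | t in [set: R]].

Lemma direction_translate p U : direction (translate p U) = U.
Proof.
rewrite /direction; case: xgetP => [W _ [q eqW]|/(_ U) noU]; last first.
  by exfalso; apply: noU; exists p.
have memT r X x : translate r X x <-> x - r \in X.
  split=> [[u uX <-]|xX]; first by rewrite addrC addKr.
  by exists (x - r); rewrite // addrC subrK.
have memE x : (x - p \in U) <-> (x - q \in W).
  by split=> /memT xX; apply/memT; rewrite ?eqW // -eqW.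
have pq : p - q \in W by apply/memE; rewrite subrr mem0v.
have UW x : (x \in U) <-> (p + x - q \in W) by split=> [xU|/memE];
  [apply/memE|]; rewrite addrAC subrr add0r.
apply/vspaceP=> x; apply/idP/idP => [xW|/UW].
  by apply/UW; rewrite addrAC memvD.
move/memvB=> /(_ _ pq); by rewrite [p + x - q]addrAC [p - q + x]addrC addrK.
Qed.

End AffineGeometry.

Section MRConfiguration.
Context {R : realType} {d n : nat}.
Implicit Types (V : 'I_n -> {fset 'rV[R]_d}) (delta : R).
Local Open Scope fset_scope.

Definition config_points V : {fset 'rV[R]_d} := \bigcup_(i <- enum 'I_n) V i.

(* Such a w is automatically different from v and u, which lie in V i. *)
Definition has_third_point V (i : 'I_n) (v u : 'rV[R]_d) : Prop :=
  exists2 w, w \in config_points V `\` V i & line v u w.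

Definition mr_configuration delta V : Prop :=
  [/\ forall i j, i != j -> [disjoint V i & V j],
      forall i j : 'I_n, (i <= j)%N -> (#|` V j| <= #|` V i|)%N
    & forall i v, v \in V i ->
        delta * #|` V i|%:R <=
          #|` [fset u in V i `\ v | `[< has_third_point V i v u >]]|%:R].

End MRConfiguration.

(* Main.v *)
Require Import Defs.
From mathcomp Require Import all_boot all_order all_algebra finmap.
From mathcomp Require Import boolp classical_sets reals.
From mathcomp Require Import sequences exp.
From mathcomp Require Import ring lra zify.

Set Implicit Arguments.
Unset Strict Implicit.
Unset Printing Implicit Defensive.

Import Order.TTheory GRing.Theory Num.Theory.
Local Open Scope ring_scope.

(** The argument gives the stronger bound [17 n / delta]. Lift every point [v]
    to the vector [(1, v)], so that collinear points become coplanar vectors, give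
    a point of [V_i] the mass [1 / |V_i|], and let [U] be a subspace of maximal
    dimension among those with [dim U <= lam * mass U], where [lam = 17 / delta].
    As the total mass is at most [n], it suffices that [U] contains all points.
    Otherwise work modulo [U]: by maximality any set of points outside [U] of
    mass [a] spans at least [lam * a] dimensions there. Under this condition an
    inner product in near radial isotropic position exists: for every point [v]
    outside [U], the squared cosines [cos^2(v, j)], weighted by [lam * mass j],
    sum to at most [4]. It is the inverse of [1 + sum_j w_j y_j^T y_j] for
    weights [w] nearly minimizing [det / prod w_j^(lam * mass j)].
    Now take the colour [i] with the largest [|V_i|] among those with points
    outside [U]; all masses outside [U] are then at least [1 / |V_i|]. On a line
    the vectors lie in a plane, where many squared cosines must be large, and summing
    over the special lines of colour [i] contradicts the upper bound [4]. *)

(** * Symmetric positive definite forms *)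

Definition bform (R : realType) (m : nat) (S : 'M[R]_m) (x y : 'rV[R]_m) : R :=
  (x *m S *m y^T) 0 0.

Definition posdef (R : realType) (m : nat) (S : 'M[R]_m) : Prop :=
  S^T = S /\ forall x, x != 0 -> 0 < bform S x x.

Section Forms.
Variables (R : realType) (m : nat).
Implicit Types (S M : 'M[R]_m) (x y z : 'rV[R]_m) (a w : R).

Lemma bformDl S x y z : bform S (x + y) z = bform S x z + bform S y z.
Proof. by rewrite /bform !mulmxDl mxE. Qed.

Lemma bformZl S a x z : bform S (a *: x) z = a * bform S x z.
Proof. by rewrite /bform -!scalemxAl mxE. Qed.

Lemma bformDr S x y z : bform S x (y + z) = bform S x y + bform S x z.
Proof. by rewrite /bform linearD /= mulmxDr mxE. Qed.

Lemma bformZr S a x z : bform S x (a *: z) = a * bform S x z.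
Proof. by rewrite /bform linearZ /= -scalemxAr mxE. Qed.

Lemma bform0l S z : bform S 0 z = 0.
Proof. by rewrite /bform !mul0mx mxE. Qed.

Lemma bformC S x y : S^T = S -> bform S x y = bform S y x.
Proof.
move=> symS; rewrite /bform -[in LHS](trmxK (_ *m _ *m _)) mxE.
by rewrite !trmx_mul trmxK symS mulmxA.
Qed.

Lemma posdef_ge0 S x : posdef S -> 0 <= bform S x x.
Proof.
move=> [_ pos]; have [->|/pos/ltW//] := eqVneq x 0.
by rewrite bform0l.
Qed.

Lemma posdef_CauchySchwarz S x y : posdef S ->
  bform S x y ^+ 2 <= bform S x x * bform S y y.
Proof.
move=> pdS; have [->|y0] := eqVneq y 0.
  by rewrite (bformC _ _ pdS.1) !bform0l expr0n mulr0.
have yy := pdS.2 _ y0; have := posdef_ge0 (x - (bform S x y / bform S y y) *: y) pdS.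
rewrite -scaleNr !(bformDl, bformDr, bformZl, bformZr) (bformC y x pdS.1).
move: (bform S x x) (bform S x y) (bform S y y) yy => p q r r0.
have -> : p + - (q / r) * q + (- (q / r) * q + - (q / r) * (- (q / r) * r))
    = (p * r - q ^+ 2) / r.
  by field; rewrite gt_eqF.
by rewrite pmulr_lge0 ?invr_gt0// subr_ge0.
Qed.

Lemma posdef1 : posdef (1%:M : 'M[R]_m).
Proof.
split=> [|x x0]; first exact: trmx1.
rewrite /bform mulmx1 mxE lt_neqAle; apply/andP; split; last first.
  by apply: sumr_ge0 => i _; rewrite mxE -expr2 sqr_ge0.
apply: contraNN x0; rewrite eq_sym psumr_eq0; last first.
  by move=> i _; rewrite mxE -expr2 sqr_ge0.
move=> /allP x0; apply/eqP/rowP => i; rewrite mxE.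
by have := x0 i (mem_index_enum i); rewrite mxE -expr2 sqrf_eq0 => /eqP.
Qed.

Lemma bform_rank1 M w x y z :
  bform (M + w *: (z^T *m z)) x y
  = bform M x y + w * (bform 1%:M x z * bform 1%:M z y).
Proof.
rewrite /bform mulmxDr mulmxDl mxE -scalemxAr -scalemxAl [in X in _ + X]mxE !mulmx1.
by rewrite mulmxA -(mulmxA (x *m z^T)) [(_ *m (z *m _)) _ _]mxE big_ord1.
Qed.

Lemma posdef_rank1 M w z : posdef M -> 0 <= w -> posdef (M + w *: (z^T *m z)).
Proof.
move=> [symM pos] w0; split=> [|x x0].
  by rewrite linearD linearZ /= trmx_mul trmxK symM.
rewrite bform_rank1 ltr_pwDl ?pos// mulr_ge0//.
by rewrite [X in _ * X](bformC _ _ (posdef1).1) -expr2 sqr_ge0.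
Qed.

Lemma posdef_unit M : posdef M -> M \in unitmx.
Proof.
move=> [_ pos]; rewrite -row_free_unit -kermx_eq0; apply/eqP/row_matrixP=> i.
rewrite row0; apply/eqP; case: (eqVneq (row i (kermx M)) 0) => // /pos.
by rewrite /bform -row_mul mulmx_ker row0 mul0mx mxE ltxx.
Qed.

Lemma bform_invmx M x : M \in unitmx ->
  bform M (x *m invmx M) (x *m invmx M) = bform (invmx M)^T x x.
Proof. by move=> uM; rewrite /bform mulmxKV// trmx_mul mulmxA. Qed.

Lemma posdef_invmx M : posdef M -> posdef (invmx M).
Proof.
move=> pdM; have uM := posdef_unit pdM; have symI : (invmx M)^T = invmx M.
  by rewrite trmx_inv pdM.1.
split=> // x x0; rewrite -{1}symI -bform_invmx//; apply: pdM.2.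
by apply: contraNneq x0 => xM0; rewrite -(mulmxKV uM x) xM0 mul0mx.
Qed.

(** Matrix determinant lemma: the bordered matrix [B] is factored into block triangular matrices in
    two ways, by eliminating with either of its diagonal blocks. *)
Lemma det_rank1 M w z : M \in unitmx ->
  \det (M + w *: (z^T *m z)) = \det M * (1 + w * bform (invmx M) z z).
Proof.
move=> uM; pose B := block_mx (1%:M : 'M_1) (- z) (w *: z^T) M.
have BE1 : B = block_mx 1%:M 0 (w *: z^T) 1%:M
               *m block_mx 1%:M (- z) 0 (M + w *: (z^T *m z)).
  rewrite mulmx_block !mul1mx !mul0mx !mulmx1 !addr0.
  by rewrite mulmxN -scalemxAl [- _ + _]addrC addrK.
have BE2 : B = block_mx (1 + w * bform (invmx M) z z)%:M (- z) 0 M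
               *m block_mx 1%:M 0 (w *: (invmx M *m z^T)) 1%:M.
  rewrite mulmx_block !mulmx1 !mulmx0 !add0r -!scalemxAr (mulmxA M).
  rewrite mulmxV// mul1mx; congr (block_mx _ _ _ _).
  apply/matrixP=> i j; rewrite !ord1 mulNmx mulmxA !mxE /bform eqxx mulr1n.
  by rewrite mxE /=; ring.
have := congr1 determinant BE1; rewrite {1}BE2 !det_mulmx !det_ublock !det_lblock.
by rewrite !det1 !mul1r !mulr1 det_scalar1 => <-; rewrite mulrC.
Qed.

End Forms.

(** * Determinants of weighted Gram sums *)

(** The minimum is taken together with 1, which covers an empty [T] and gives the bound [g <= 1]
    used later to compare powers of [g]. *)
Lemma finite_pos_lower_bound (R : realType) (T : finType) (f : T -> R) :
  (forall t, 0 < f t) -> exists g, [/\ 0 < g, g <= 1 & forall t, g <= f t].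
Proof.
move=> f0; exists (\big[Order.min/1]_t f t); split=> [||t].
- by elim/big_ind: _ => // x y x0 y0; rewrite lt_min x0.
- exact: bigmin_le_id.
- exact: bigmin_le_cond.
Qed.

Lemma dim_add_vline (K : fieldType) (vT : vectType K) (x : vT) (W : {vspace vT}) :
  x \notin W -> \dim (<[x]> + W) = (\dim W).+1.
Proof.
move=> xW; rewrite dimv_disjoint_sum ?dim_vline.
  by case: eqVneq xW => // ->; rewrite mem0v.
apply/eqP; rewrite -subv0; apply/subvP => v; rewrite memv_cap => /andP[/vlineP[a ->]].
have [->|a0] := eqVneq a 0; first by rewrite scale0r !mem0v.
by move=> axW; case/negP: xW; rewrite -(scalerK a0 x) memvZ.
Qed.

(** One step of Abel summation for [det_gram_greedy]: [b] is the mass of a list, [r] the dimension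
    of its span, and the threshold moves between [t] and [k]. *)
Lemma threshold_shift (R : realType) (a b r t k : R) :
  t <= k -> b <= r -> a + (k - t) * b + t * r <= a + k * r.
Proof. by move=> tk br; nra. Qed.

(** With nonnegative weights the identity summand keeps the matrix positive definite, hence
    invertible, even when the vectors do not span the space. *)
Definition gram (R : realType) (m : nat) (I : Type) (y : I -> 'rV[R]_m)
    (w : I -> R) (s : seq I) : 'M[R]_m :=
  1%:M + \sum_(i <- s) w i *: ((y i)^T *m y i).

Section Gram.
Variables (R : realType) (m : nat) (I : finType) (y : I -> 'rV[R]_m).
Implicit Types (w k : I -> R) (s : seq I).

Lemma gram_nil w : gram y w [::] = 1%:M.
Proof. by rewrite /gram big_nil addr0. Qed.

Lemma gram_cons w i s : gram y w (i :: s) = gram y w s + w i *: ((y i)^T *m y i).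
Proof. by rewrite /gram big_cons addrCA addrC. Qed.

Lemma posdef_gram w s : (forall i, 0 <= w i) -> posdef (gram y w s).
Proof.
move=> w0; elim: s => [|i s IH]; first by rewrite gram_nil; exact: posdef1.
by rewrite gram_cons; apply: posdef_rank1.
Qed.

Lemma bform_gram w s x z : bform (gram y w s) x z =
  bform 1%:M x z + \sum_(i <- s) w i * (bform 1%:M x (y i) * bform 1%:M (y i) z).
Proof.
elim: s => [|i s IH]; first by rewrite gram_nil big_nil addr0.
by rewrite gram_cons bform_rank1 IH big_cons -addrA; congr (_ + _); rewrite addrC.
Qed.

Lemma det_gram_cons w i s : (forall i, 0 <= w i) ->
  \det (gram y w (i :: s)) =
  \det (gram y w s) * (1 + w i * bform (invmx (gram y w s)) (y i) (y i)).
Proof. by move=> w0; rewrite gram_cons det_rank1 ?posdef_unit//; apply: posdef_gram. Qed.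

Lemma det_gram_gt0 w s : (forall i, 0 <= w i) -> 0 < \det (gram y w s).
Proof.
move=> w0; elim: s => [|i s IH]; first by rewrite gram_nil det1.
rewrite det_gram_cons// mulr_gt0// ltr_pwDl// mulr_ge0//.
by apply/posdef_ge0/posdef_invmx/posdef_gram.
Qed.

(** The map [f] complementary to a projection onto the span kills [X] but not [x]; a coordinate of
    [f] that is nonzero at [x] is represented by a column of its matrix. *)
Lemma separating_vector (x : 'rV[R]_m) (X : seq 'rV[R]_m) : x \notin <<X>>%VS ->
  exists z, (forall u, u \in X -> bform 1%:M u z = 0) /\ bform 1%:M x z != 0.
Proof.
move=> xX; pose f := (\1 - projv <<X>>)%VF.
have fE u : f u = u - projv <<X>> u by rewrite !lfun_simp.
have [j fxj] : exists j, f x 0 j != 0.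
  apply/existsP; apply: contraNT xX; rewrite negb_exists => /forallP fx.
  have /eqP : f x = 0 by apply/rowP => j; rewrite mxE; apply/eqP/negbNE/fx.
  by rewrite fE subr_eq0 => /eqP ->; exact: memv_proj.
exists (col j (lin1_mx f))^T.
have dotE u : bform 1%:M u (col j (lin1_mx f))^T = f u 0 j.
  by rewrite /bform mulmx1 trmxK -mul_rV_lin1 colE mulmxA -colE mxE.
split=> [u uX|]; rewrite dotE// fE projv_id ?subrr ?mxE//.
exact: memv_span.
Qed.

(** The bound must be uniform in the weights. If [z] is orthogonal to all [y j] with [j] in [s] but
    not to [y i], then [bform M z z = bform 1%:M z z] for the Gram matrix [M], whatever the weights.
    Cauchy-Schwarz for [M], applied to [z] and [y i *m invmx M], then gives a bound in [y i] and [z]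
    alone. *)
Lemma leverage_lower_bound : exists g, [/\ 0 < g, g <= 1 &
  forall s i w, y i \notin <<map y s>>%VS -> (forall j, 0 <= w j) ->
    g <= bform (invmx (gram y w s)) (y i) (y i)].
Proof.
(* There are infinitely many lists, but [z] depends only on the set of their entries, so a minimum
   over finitely many pairs is enough. *)
have /choice[f fP] (p : {set I} * I) : exists g : R, 0 < g /\
    forall s w, s =i p.1 -> y p.2 \notin <<map y s>>%VS -> (forall j, 0 <= w j) ->
    g <= bform (invmx (gram y w s)) (y p.2) (y p.2).
  case: p => T i /=.
  have [[s0 s0T /separating_vector[z [zs0 zi]]]|noS] :=
    pselect (exists2 s, s =i T & y i \notin <<map y s>>%VS); last first.
    by exists 1; split=> // s w sT yis; exfalso; apply: noS; exists s.
  have z0 : z != 0.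
    by apply: contraNneq zi => ->; rewrite bformC ?trmx1// bform0l.
  have zz := (posdef1 R m).2 _ z0.
  exists (bform 1%:M (y i) z ^+ 2 / bform 1%:M z z); split.
    by rewrite divr_gt0// lt_neqAle sqr_ge0 eq_sym expf_neq0.
  move=> s w sT _ w0; have pdM := posdef_gram s w0; have uM := posdef_unit pdM.
  rewrite ler_pdivrMr//; set u := y i *m invmx (gram y w s).
  have -> : bform 1%:M (y i) z = bform (gram y w s) u z.
    by rewrite /bform mulmxKV// mulmx1.
  have -> : bform 1%:M z z = bform (gram y w s) z z.
    rewrite bform_gram big_seq big1 ?addr0// => j js.
    by rewrite zs0 ?mulr0// map_f// s0T -sT.
  have -> : bform (invmx (gram y w s)) (y i) (y i) = bform (gram y w s) u u.
    by rewrite bform_invmx// trmx_inv pdM.1.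
  exact: posdef_CauchySchwarz.
have [g [g0 g1 gf]] := finite_pos_lower_bound (fun p => (fP p).1).
exists g; split=> // s i w yis w0; apply: le_trans (gf ([set j in s], i)) _.
by apply: (fP ([set j in s], i)).2 => // j; rewrite inE.
Qed.

Variable c : I -> R.
Hypothesis c_dim : forall s, uniq s -> \sum_(i <- s) c i <= (\dim <<map y s>>)%:R.

(* The exponent is a greedy (matroid) estimate: lowering the threshold t costs
   c(s) <= dim <<s>> on the left and gains dim <<s>> on the right. *)
Lemma det_gram_greedy (g : R) : 0 < g -> g <= 1 ->
  (forall s i w, y i \notin <<map y s>>%VS -> (forall j, 0 <= w j) ->
    g <= bform (invmx (gram y w s)) (y i) (y i)) ->
  forall k s t, uniq s -> sorted (fun i j => k i <= k j) s ->
    (forall i, i \in s -> t <= k i) ->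
    let r := \dim <<map y s>>%VS in
    g ^+ r * expR (\sum_(i <- s) c i * (k i - t) + t * r%:R)
      <= \det (gram y (expR \o k) s).
Proof.
move=> g0 g1 gP k; elim=> [|i s IH] t us ss ts /=.
  by rewrite span_nil dimv0 big_nil mulr0 addr0 expR0 expr0 mulr1 gram_nil det1.
have w0 j : 0 <= (expR \o k) j by exact: expR_ge0.
have us' : uniq s by case/andP: us.
(* As the list is sorted, [k i] bounds the exponents of the tail from below and can be its
   threshold. *)
have {IH} := IH (k i) us' (path_sorted ss) _.
have ks j : j \in s -> k i <= k j.
  move=> js; have /order_path_min/allP/(_ _ js) := ss; apply.
  by move=> a b d; exact: le_trans.
move=> /(_ ks) /=; rewrite det_gram_cons// span_cons.
set W := <<map y s>>%VS; set r := \dim W => IH.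
have ti : t <= k i by rewrite ts ?mem_head.
have cis : \sum_(j <- i :: s) c j * (k j - t) =
    \sum_(j <- s) c j * (k j - k i) + (k i - t) * \sum_(j <- i :: s) c j.
  rewrite !big_cons (mulrDr (k i - t)) mulr_sumr addrCA -big_split/= mulrC; congr (_ + _).
  by apply: eq_bigr => j _; ring.
have cdim := c_dim us; rewrite /= span_cons -/W in cdim.
(* Inside [W] the dimension stays and the new determinant factor is at least 1; outside, the
   dimension grows by one and the factor is at least [expR (k i) * g]. *)
have [yW|yW] := boolP (y i \in W).
  have WE : (<[y i]> + W)%VS = W by apply/addv_idPr; rewrite -memvE.
  rewrite WE -/r in cdim *; apply: le_trans (le_trans _ IH) _.
    by rewrite ler_pM2l ?exprn_gt0// ler_expR cis; exact: threshold_shift.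
  rewrite ler_peMr ?(ltW (det_gram_gt0 _ _))// lerDl mulr_ge0//.
  by apply/posdef_ge0/posdef_invmx/posdef_gram.
have rE : \dim (<[y i]> + W) = r.+1 by exact: dim_add_vline.
rewrite rE in cdim *; apply: (@le_trans _ _
   ((g ^+ r * expR (\sum_(j <- s) c j * (k j - k i) + k i * r%:R)) * (expR (k i) * g))).
  rewrite exprSr -!mulrA ler_pM2l ?exprn_gt0// mulrA [leRHS]mulrC ler_pM2l//.
  rewrite -expRD ler_expR cis.
  by rewrite -[leRHS]addrA -[X in k i * _ + X]mulr1 -mulrDr natr1; exact: threshold_shift.
apply: ler_pM => //; rewrite ?mulr_ge0 ?exprn_ge0 ?expR_ge0 ?(ltW g0)//.
by rewrite ler_wpDl// ler_wpM2l ?expR_ge0// gP.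
Qed.

(** This is the greedy estimate at threshold 0 for the sorted exponents. Since [g <= 1] and spans
    have dimension at most [m], the constant [g ^+ m] serves all [k]. *)
Lemma det_gram_lower_bound : exists2 g, 0 < g & forall k, (forall i, 0 <= k i) ->
  g * expR (\sum_i c i * k i) <= \det (gram y (expR \o k) (index_enum I)).
Proof.
have [g [g0 g1 gP]] := leverage_lower_bound; exists (g ^+ m); first exact: exprn_gt0.
move=> k k0; pose le := fun i j => k i <= k j.
have ps : perm_eq (sort le (index_enum I)) (index_enum I) by apply/permPl/perm_sort.
have us : uniq (sort le (index_enum I)) by rewrite sort_uniq index_enum_uniq.
have ss : sorted le (sort le (index_enum I)) by apply: sort_sorted => a b; exact: le_total.
have := det_gram_greedy g0 g1 gP us ss (fun i _ => k0 i).
rewrite /= mul0r addr0 (perm_big _ ps) /gram (perm_big _ ps)/=.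
under eq_bigr do rewrite subr0.
apply: le_trans; rewrite ler_pM2r ?expR_gt0// ler_wiXn2l ?(ltW g0)//.
by rewrite (leq_trans (dimvS (subvf _)))// dimvf /dim/= mul1n.
Qed.

End Gram.

(** * Near radial isotropic position *)

(* The squared cosine of the angle between x and y (0 if one of them is 0). *)
Definition corr (R : realType) (m : nat) (S : 'M[R]_m) (x y : 'rV[R]_m) : R :=
  bform S x y ^+ 2 / (bform S x x * bform S y y).

Lemma expR1_le4 (R : realType) : expR 1 <= 4 :> R.
Proof.
have := expR_ge1Dx (- (1 / 2) : R); rewrite expRN => h.
have e0 : 0 < expR (1 / 2 : R) := expR_gt0 _.
have : expR (1 / 2 : R) <= 2.
  rewrite -[leLHS]invrK -[leRHS]invrK lef_pV2 ?posrE ?invr_gt0//.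
  by apply: le_trans h; lra.
have -> : expR (1 : R) = expR (1 / 2) * expR (1 / 2).
  by rewrite -expRD; congr expR; field.
by move=> e2; nra.
Qed.

Section Isotropic.
Variables (R : realType) (m : nat) (I : finType) (y : I -> 'rV[R]_m) (c : I -> R).
Hypothesis c0 : forall i, 0 < c i.
Hypothesis c_dim : forall s, uniq s -> \sum_(i <- s) c i <= (\dim <<map y s>>)%:R.

Let M (k : I -> nat) := gram y (fun i => expR (k i)%:R) (index_enum I).

(** Raising one exponent adds a rank one term of weight [expR (k i) * (expR 1 - 1)]. With
    [expR 1 <= 4] the determinant grows by a factor of at most [1 + 3 * c i / 4], short of the
    factor [expR (c i)] gained by [expR (sum c k)]. *)
Lemma det_gram_incr (k : I -> nat) i :
  expR (k i)%:R * bform (invmx (M k)) (y i) (y i) <= c i / 4 ->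
  \det (M (fun j => k j + (j == i))%N) <= \det (M k) * expR (c i - c i / 4).
Proof.
move=> tau; have w0 j : 0 <= expR ((k j)%:R : R) by exact: expR_ge0.
have pdM : posdef (M k) by apply: posdef_gram.
have -> : M (fun j => k j + (j == i))%N =
    M k + (expR (k i)%:R * (expR 1 - 1)) *: ((y i)^T *m y i).
  rewrite /M /gram -addrA; congr (_ + _); rewrite (bigD1 i)//= [in RHS](bigD1 i)//=.
  rewrite [RHS]addrAC; congr (_ + _); last first.
    by apply: eq_bigr => j /negPf ->; rewrite addn0.
  rewrite -scalerDl; congr (_ *: _).
  by rewrite eqxx natrD expRD; ring.
rewrite det_rank1 ?posdef_unit// ler_pM2l; last exact: det_gram_gt0.
have t0 : 0 <= expR (k i)%:R * bform (invmx (M k)) (y i) (y i).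
  by rewrite mulr_ge0// posdef_ge0//; exact: posdef_invmx.
rewrite mulrAC; move: (expR (k i)%:R * _) tau t0 => t tau t0.
apply: (@le_trans _ _ (1 + (c i - c i / 4))); last exact: expR_ge1Dx.
rewrite lerD2l; have := expR1_le4 R; have := expR_ge1Dx (1 : R).
move: (expR 1) (c i) tau t0 => e b; nra.
Qed.

(* Each unit increase of an exponent violating the bound decreases
   det (M k) / expR (sum c k) by a fixed factor, and this ratio is bounded below. *)
Lemma exists_leverage_ge : exists k : I -> nat,
  forall i, c i / 4 < expR (k i)%:R * bform (invmx (M k)) (y i) (y i).
Proof.
apply: contrapT => noK.
have bad k : exists i, expR (k i)%:R * bform (invmx (M k)) (y i) (y i) <= c i / 4.
  apply: contrapT => h; apply: noK; exists k => i; rewrite ltNge; apply/negP => hi.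
  by apply: h; exists i.
have [mu [mu0 _ muc]] := finite_pos_lower_bound c0.
(* After [n] increments the ratio has dropped by the factor [expR (- n * mu / 4)], where [mu] bounds
   all [c i] from below. *)
have desc (n : nat) : exists k : I -> nat, \det (M k) <=
    \det (M (fun=> 0%N)) * expR (\sum_i c i * (k i)%:R - n%:R * (mu / 4)).
  elim: n => [|n [k IH]].
    exists (fun=> 0%N); rewrite mul0r subr0 big1 ?expR0 ?mulr1// => i _.
    by rewrite mulr0.
  have [i /det_gram_incr h] := bad k; exists (fun j => k j + (j == i))%N.
  apply: le_trans h _; apply: (le_trans (ler_wpM2r (expR_ge0 _) IH)).
  rewrite -mulrA -expRD ler_pM2l; last by apply: det_gram_gt0 => j; exact: expR_ge0.
  rewrite ler_expR [in leRHS](eq_bigr (fun j => c j * (k j)%:R + c j * (j == i)%:R)); last first.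
    by move=> j _; rewrite natrD mulrDr.
  rewrite big_split /= [X in _ <= _ + X - _](bigD1 i)//= eqxx mulr1.
  rewrite [X in _ <= _ + (_ + X) - _]big1 => [|j /negPf ->]; last by rewrite mulr0.
  have := muc i; rewrite -[n.+1%:R]natr1 addr0; move: (\sum_i _) (c i) => A b; lra.
have [g g0 gP] := det_gram_lower_bound c_dim.
have D0 : 0 < \det (M (fun=> 0%N)) by apply: det_gram_gt0 => j; exact: expR_ge0.
set D := \det _ in D0 desc.
(* Chosen so that [expR (n * mu / 4) >= 1 + n * mu / 4 > D / g], which contradicts the lower bound
   [g] on the ratio. *)
pose n := (Num.truncn (D / g / (mu / 4))).+1.
have [k kn] := desc n.
have := le_trans (gP (fun i => (k i)%:R) (fun i => ler0n _ _)) kn.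
rewrite expRD expRN mulrCA [leLHS]mulrC ler_pM2l ?expR_gt0// ler_pdivlMr ?expR_gt0//.
apply/negP; rewrite -ltNge.
have : D / g / (mu / 4) < n%:R by rewrite truncnS_gt.
rewrite !ltr_pdivrMr ?divr_gt0// => h; apply: lt_le_trans h _.
rewrite [leRHS]mulrC ler_pM2r//; apply: le_trans (expR_ge1Dx _).
by rewrite lerDr.
Qed.

(** Take [S = invmx (M k)]. Evaluating [M k] at [y i *m S] gives [bform S (y i) (y i)], which
    therefore dominates the sum of [expR (k j) * bform S (y i) (y j) ^+ 2]. The leverage bound
    replaces [c j] by at most [4 * expR (k j) * bform S (y j) (y j)]. *)
Lemma isotropic_form : exists S : 'M[R]_m, posdef S /\
  forall i, \sum_j c j * corr S (y i) (y j) <= 4.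
Proof.
have [k kP] := exists_leverage_ge; have w0 i : 0 <= expR ((k i)%:R : R) by exact: expR_ge0.
have pdM : posdef (M k) by apply: posdef_gram.
have pdS := posdef_invmx pdM; exists (invmx (M k)); split=> // i.
have bpos j : 0 < bform (invmx (M k)) (y j) (y j).
  have := lt_trans (divr_gt0 (c0 j) (ltr0n R 4)) (kP j).
  by rewrite pmulr_rgt0// expR_gt0.
have sum_le : \sum_j expR (k j)%:R * bform (invmx (M k)) (y i) (y j) ^+ 2
    <= bform (invmx (M k)) (y i) (y i).
  have <- : bform (M k) (y i *m invmx (M k)) (y i *m invmx (M k))
      = bform (invmx (M k)) (y i) (y i).
    by rewrite bform_invmx ?posdef_unit// trmx_inv pdM.1.
  rewrite [leRHS]bform_gram ler_wpDl ?posdef_ge0//; first exact: posdef1.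
  rewrite le_eqVlt; apply/orP; left; apply/eqP/eq_bigr => j _; congr (_ * _).
  rewrite [X in _ = _ * X](bformC _ _ (posdef1 _ _).1) -expr2; congr (_ ^+ 2).
  by rewrite /bform mulmx1.
apply: (@le_trans _ _ (\sum_j 4 / bform (invmx (M k)) (y i) (y i) *
    (expR (k j)%:R * bform (invmx (M k)) (y i) (y j) ^+ 2))); last first.
  by rewrite -mulr_sumr mulrAC ler_pdivrMr// ler_pM2l.
apply: ler_sum => j _; rewrite /corr.
have := kP j; have := bpos j; have := bpos i.
move: (bform _ (y i) (y i)) (bform _ (y j) (y j)) (bform _ (y i) (y j)) => bi bj b bi0 bj0.
rewrite ltr_pdivrMr// => kj.
rewrite [leLHS](_ : _ = (c j / bj) * (b ^+ 2 / bi)); last first.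
  by field; rewrite !gt_eqF.
rewrite [leRHS](_ : _ = (4 * expR (k j)%:R) * (b ^+ 2 / bi)); last first.
  by field; rewrite gt_eqF.
apply: ler_wpM2r; first by rewrite divr_ge0 ?sqr_ge0// ltW.
by rewrite ler_pdivrMr//; apply: ltW; rewrite mulrC mulrA in kj *.
Qed.

End Isotropic.

(** * Squared cosines of coplanar vectors *)

Section Correlation.
Variables (R : realType) (m : nat) (S : 'M[R]_m).
Hypothesis pdS : posdef S.
Implicit Types x y z : 'rV[R]_m.

Lemma corr_ge0 x y : 0 <= corr S x y.
Proof. by rewrite divr_ge0 ?sqr_ge0// mulr_ge0// posdef_ge0. Qed.

Lemma corrC x y : corr S x y = corr S y x.
Proof. by rewrite /corr (bformC x y pdS.1) [_ * bform S y y]mulrC. Qed.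

Lemma corr_parallel x y a : x != 0 -> y != 0 -> y = a *: x -> corr S x y = 1.
Proof.
move=> x0 y0 yE; have a0 : a != 0 by apply: contraNneq y0 => a0; rewrite yE a0 scale0r.
have := pdS.2 _ x0; rewrite /corr yE !(bformZl, bformZr) => /lt0r_neq0 b0.
by field; rewrite a0 b0.
Qed.

Lemma corr_id x : x != 0 -> corr S x x = 1.
Proof. by move=> x0; rewrite (corr_parallel x0 x0 (a := 1))// scale1r. Qed.

(* With G the 2 x 2 sum of x^T x over the normalised coordinate vectors x, the
   double sum is tr (G^2) >= (tr G)^2 / 2. *)
Lemma sum_corr_orthogonal (T : finType) (L : {set T}) (y : T -> 'rV[R]_m) q1 q2
    (a b : T -> R) : bform S q1 q2 = 0 ->
  (forall x : T, x \in L -> y x != 0 /\ y x = a x *: q1 + b x *: q2) ->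
  #|L|%:R ^+ 2 / 2 <= \sum_(x in L) \sum_(z in L) corr S (y x) (y z).
Proof.
move=> q12 yE; pose n (x : T) := bform S (y x) (y x).
pose b1 := bform S q1 q1; pose b2 := bform S q2 q2.
have n0 (x : T) : x \in L -> n x != 0 by move=> /yE[/(pdS.2)/lt0r_neq0].
have q21 : bform S q2 q1 = 0 by rewrite bformC ?pdS.1.
have bE (x z : T) : x \in L -> z \in L ->
    bform S (y x) (y z) = a x * a z * b1 + b x * b z * b2.
  move=> /yE[_ ->] /yE[_ ->]; rewrite !(bformDl, bformDr, bformZl, bformZr) q12 q21.
  by rewrite -/b1 -/b2; ring.
pose A (x : T) := a x ^+ 2 * b1 / n x; pose B (x : T) := b x ^+ 2 * b2 / n x.
pose G (x : T) := a x * b x / n x.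
have AB : \sum_(x in L) A x + \sum_(x in L) B x = #|L|%:R.
  rewrite -big_split/= -sumr_const; apply: eq_bigr => x xL.
  rewrite /A /B -mulrDl -[RHS](divff (n0 x xL)); congr (_ / _).
  by rewrite /n bE// !expr2.
(* Each squared cosine expands to [A x * A z + B x * B z + 2 * b1 * b2 * G x * G z], so the double
   sum splits into squares. *)
have -> : \sum_(x in L) \sum_(z in L) corr S (y x) (y z) =
    (\sum_(x in L) A x) ^+ 2 + (\sum_(x in L) B x) ^+ 2
    + 2 * (b1 * b2) * (\sum_(x in L) G x) ^+ 2.
  rewrite !expr2 !big_distrlr/= mulr_sumr -!big_split/=; apply: eq_bigr => x xL.
  rewrite mulr_sumr -!big_split/=; apply: eq_bigr => z zL.
  by rewrite /corr bE// -!/(n _) /A /B /G; field; rewrite !n0.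
have b1b2 : 0 <= b1 * b2 by rewrite mulr_ge0 ?posdef_ge0.
have : 0 <= b1 * b2 * (\sum_(x in L) G x) ^+ 2 by rewrite mulr_ge0 ?sqr_ge0.
have := sqr_ge0 (\sum_(x in L) A x - \sum_(x in L) B x).
rewrite -AB; move: (\sum_(x in L) A x) (\sum_(x in L) B x) (b1 * b2 * _) => s t g.
by rewrite -mulrA; nra.
Qed.

(** One Gram-Schmidt step with respect to [S] reduces to orthogonal generators. *)
Lemma sum_corr_plane (T : finType) (L : {set T}) (y : T -> 'rV[R]_m) q1 q2 : q1 != 0 ->
  (forall x : T, x \in L -> y x != 0 /\ exists a b, y x = a *: q1 + b *: q2) ->
  #|L|%:R ^+ 2 / 2 <= \sum_(x in L) \sum_(z in L) corr S (y x) (y z).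
Proof.
move=> q10 yL; pose t := bform S q1 q2 / bform S q1 q1.
have /choice[ab abP] (x : T) : exists ab : R * R, x \in L ->
    y x = ab.1 *: q1 + ab.2 *: (q2 - t *: q1).
  have [xL|] := boolP (x \in L); last by exists (0, 0).
  have [_ [a [b ->]]] := yL x xL; exists (a + b * t, b) => _ /=.
  by rewrite scalerDl scalerBr scalerA -addrA; congr (_ + _); rewrite addrC subrK.
apply: (@sum_corr_orthogonal _ _ _ q1 (q2 - t *: q1)
  (fun x : T => (ab x).1) (fun x : T => (ab x).2)).
  rewrite -scaleNr bformDr bformZr mulNr divfK ?subrr//.
  exact/lt0r_neq0/pdS.2.
by move=> x xL; split; [have [] := yL x xL|exact: abP].
Qed.

End Correlation.

(** * Special lines *)

Section Lines.
Variables (R : realType) (m : nat) (P : finType) (p : P -> 'rV[R]_m).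
Hypothesis p0 : forall x, p x != 0.
Hypothesis p_indep : forall x z, x != z -> p x \notin <[p z]>%VS.
Implicit Types (x z v u w t : P).

Definition pline x z : {set P} := [set t | p t \in (<[p x]> + <[p z]>)%VS].

Lemma pline_left x z : x \in pline x z.
Proof. by rewrite inE (subvP (addvSl _ _))// memv_line. Qed.

Lemma pline_right x z : z \in pline x z.
Proof. by rewrite inE (subvP (addvSr _ _))// memv_line. Qed.

Lemma plineP x z t : t \in pline x z -> exists a b, p t = a *: p x + b *: p z.
Proof.
rewrite inE => /memv_addP[_ /vlineP[a ->] [_ /vlineP[b ->] ->]].
by exists a, b.
Qed.

Lemma pline_eq v u x z : v != u -> x != z -> x \in pline v u -> z \in pline v u ->
  pline x z = pline v u.
Proof.
move=> vu xz; rewrite !inE => xl zl; apply/setP => t; rewrite !inE.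
have sub : (<[p x]> + <[p z]> <= <[p v]> + <[p u]>)%VS by rewrite subv_add -!memvE xl.
have dim2 x' z' : x' != z' -> \dim (<[p x']> + <[p z']>) = 2%N.
  by move=> xz'; rewrite dim_add_vline ?p_indep// dim_vline p0.
suff /eqP -> : (<[p x]> + <[p z]> == <[p v]> + <[p u]>)%VS by [].
by rewrite eqEdim sub !dim2.
Qed.

Variables (T : eqType) (col : P -> T) (f : 'End('rV[R]_m)) (S : 'M[R]_m).
Hypothesis pdS : posdef S.

(** In the application [f] has kernel [U], so the alive points are those outside [U]. *)
Let alive x := f (p x) != 0.

(** The dead point [z] collapses the images of the line to multiples of [f (p v)], so every
    correlation is 1 and the right side counts alive points other than [v]. No second point is dead,
    since two would kill the whole line. *)
Lemma line_sum_parallel v0 u0 w z v : v0 != u0 ->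
  w \in pline v0 u0 -> col w != col v0 -> z \in pline v0 u0 -> ~~ alive z ->
  v \in pline v0 u0 -> alive v -> col v = col v0 ->
  #|[set u in pline v0 u0 | (col u == col v0) && (u != v)]|%:R
  <= \sum_(j in pline v0 u0 | (j != v) && alive j) corr S (f (p v)) (f (p j)) :> R.
Proof.
move=> vu0 wl colw zl dz vl av colv.
have vz : v != z by apply: contraNneq dz => <-.
have lE := pline_eq vu0 vz vl zl.
have unique_dead x : x \in pline v0 u0 -> ~~ alive x -> x = z.
  move=> xl dx; apply/eqP; apply: contraTT av => xz.
  have : v \in pline x z by rewrite (pline_eq vu0 xz xl zl).
  move=> /plineP[a [b pv]]; rewrite /alive pv linearD !linearZ /=.
  by move: dx dz; rewrite /alive !negbK => /eqP -> /eqP ->; rewrite !scaler0 addr0.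
set J := [set j in pline v0 u0 | (j != v) && alive j].
have -> : \sum_(j in pline v0 u0 | (j != v) && alive j) corr S (f (p v)) (f (p j))
    = #|J|%:R.
  rewrite -sumr_const; apply: eq_big => [j|j /and3P[jl _ aj]]; first by rewrite !inE.
  move: jl; rewrite -lE => /plineP[a [b pj]].
  apply: (corr_parallel pdS av aj (a := a)).
  move: dz; rewrite /alive negbK => /eqP fz.
  by rewrite pj linearD !linearZ /= fz scaler0 addr0.
rewrite ler_nat; have [colz|colz] := eqVneq (col z) (col v0); last first.
  apply: subset_leq_card; apply/fintype.subsetP => u.
  rewrite finset.in_set => /and3P[ul /eqP cu uv].
  rewrite finset.in_set ul uv /=; apply: contraNT colz => du.
  by rewrite -(unique_dead u)// cu.
(* If [z] has the colour of [v0], it is counted on the left only; the alive point [w] of another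
   colour makes up for it. *)
have wJ : w \in J.
  have wz : w != z by apply: contraNneq colw => ->; rewrite colz.
  rewrite finset.in_set wl /=; apply/andP; split.
    by apply: contraNneq colw => ->; rewrite colv.
  by apply: contraNT wz => dw; rewrite (unique_dead w).
rewrite (cardsD1 w J) wJ; apply: (@leq_trans #|z |: (J :\ w)|); last first.
  by rewrite cardsU1; case: (_ \notin _).
apply: subset_leq_card; apply/fintype.subsetP => u.
  rewrite finset.in_set => /and3P[ul /eqP cu uv].
rewrite in_setU1 in_setD1 finset.in_set ul uv /=; case: eqVneq => //= uz.
rewrite (contraNneq _ colw) => [/=|<-]; last by rewrite cu.
by apply: contraNT uz => du; rewrite (unique_dead u).
Qed.

(** For [r = #|A|], the planar bound on [A] alone leaves [r^2 / 2 - r] off the diagonal, which is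
    useless for [r = 2]. Hence it is applied to [A] together with the third point [w]. *)
Lemma line_sum_plane v0 u0 w : v0 != u0 -> 
  w \in pline v0 u0 -> col w != col v0 -> {in pline v0 u0, forall z, alive z} ->
  let A := [set v in pline v0 u0 | (col v == col v0) && alive v] in
  (0 < #|A|)%N ->
  #|A|%:R * (#|A|%:R - 1) <= 4 * \sum_(v in A)
    \sum_(j in pline v0 u0 | (j != v) && alive j) corr S (f (p v)) (f (p j)) :> R.
Proof.
move=> vu0 wl colw all_alive A A0.
have Al v : v \in A -> v \in pline v0 u0 by rewrite finset.in_set => /andP[].
have wA : w \notin A by rewrite finset.in_set (negPf colw) andbF.
have := @sum_corr_plane _ _ S pdS _ (w |: A) (fun x => f (p x)) (f (p v0)) (f (p u0))
  (all_alive _ (pline_left _ _)).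
have wAl x : x \in w |: A -> x \in pline v0 u0 by rewrite in_setU1 => /predU1P[->|/Al].
move=> /(_ _)/wrap[x /wAl xl|].
  split; first exact: all_alive.
  by have [a [b ->]] := plineP xl; exists a, b; rewrite linearD !linearZ.
rewrite cardsU1 wA /= natrD big_setU1//= big_setU1//= corr_id//; last exact: all_alive.
under [X in _ + _ + X]eq_bigr do rewrite big_setU1//= (corrC pdS).
rewrite big_split /=.
set W := \sum_(i in A) corr S (f (p w)) (f (p i)); set Q := \sum_(i in A) \sum_(j in A) _.
set X := \sum_(v in A) _ => Qge.
have : Q - #|A|%:R + W <= X.
  rewrite -sumr_const -sumrB -big_split /=; apply: ler_sum => v vA.
  rewrite [in leLHS](bigD1 v vA)/= corr_id//; last exact/all_alive/Al.
  rewrite [1 + _]addrC addrK.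
  rewrite [leRHS](bigD1 w)/=; last by rewrite wl all_alive//= andbT; apply: contraNneq wA => ->.
  rewrite addrC (corrC pdS) lerD2l big_mkcond [leRHS]big_mkcond; apply: ler_sum => j _.
  case: ifP => [/andP[jA jv]|_]; last by case: ifP => // _; exact: corr_ge0.
  have jl := Al _ jA; rewrite jl jv all_alive//= ifT//.
  by apply: contraNneq wA => <-.
have r1 : 1 <= #|A|%:R :> R by rewrite ler1n.
have W0 : 0 <= W by apply: sumr_ge0 => v _; exact: corr_ge0.
have Qr : #|A|%:R <= Q.
  rewrite -sumr_const; apply: ler_sum => v vA; rewrite (bigD1 v vA)/= corr_id//.
    by rewrite lerDl sumr_ge0// => j _; exact: corr_ge0.
  exact/all_alive/Al.
(* From [(r + 1)^2 / 2 <= 1 + 2 * W + Q], [Q - r + W <= X] and [r <= Q] follows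
   [4 * X >= r^2 - 1 >= r * (r - 1)]. *)
move: Qge Qr; move: (#|A|%:R) r1 => r r1; nra.
Qed.

(** A dead point on the line gives the parallel case, even without the factor 4. Otherwise all
    points are alive and the left side is exactly [#|A| * (#|A| - 1)]. *)
Lemma line_sum v0 u0 w : v0 != u0 -> alive v0 ->
  w \in pline v0 u0 -> col w != col v0 ->
  let A := [set v in pline v0 u0 | (col v == col v0) && alive v] in
  \sum_(v in A) #|[set u in pline v0 u0 | (col u == col v0) && (u != v)]|%:R
  <= 4 * \sum_(v in A)
    \sum_(j in pline v0 u0 | (j != v) && alive j) corr S (f (p v)) (f (p j)) :> R.
Proof.
move=> vu0 av0 wl colw /=.
set A := [set v in pline v0 u0 | (col v == col v0) && alive v].
have [/exists_inP[z zl dz]|] := boolP [exists z in pline v0 u0, ~~ alive z].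
  have h : \sum_(v in A) #|[set u in pline v0 u0 | (col u == col v0) && (u != v)]|%:R
      <= \sum_(v in A) \sum_(j in pline v0 u0 | (j != v) && alive j)
           corr S (f (p v)) (f (p j)) :> R.
    apply: ler_sum => v; rewrite finset.in_set => /and3P[vl /eqP cv av].
    exact: (line_sum_parallel vu0 wl colw zl dz).
  apply: le_trans h _; rewrite ler_peMl ?ler1n//; apply: sumr_ge0 => v _.
  by apply: sumr_ge0 => j _; exact: corr_ge0.
rewrite negb_exists_in => /forall_inP no_dead.
have all_alive : {in pline v0 u0, forall z, alive z} by move=> z /no_dead; rewrite negbK.
have v0A : v0 \in A by rewrite finset.in_set pline_left eqxx.
have A0 : (0 < #|A|)%N by apply/card_gt0P; exists v0.
apply: le_trans (line_sum_plane vu0 wl colw all_alive A0).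
rewrite (eq_bigr (fun=> #|A|%:R - 1)); first by rewrite sumr_const mulr_natl.
move=> v vA; rewrite (cardsD1 v A) vA natrD addrC addKr; congr (_%:R).
apply: eq_card => u; rewrite in_setD1 !finset.in_set.
case ul : (p u \in _) => /=; last by rewrite andbF.
by rewrite all_alive ?finset.in_set// andbT andbC.
Qed.

Definition special v u : bool :=
  [&& col u == col v, u != v & [exists w in pline v u, col w != col v]].

(** Double counting over the set [L] of special lines through an alive point of colour [i]: every
    special pair lies on a line of [L] ([cover]), and two distinct points lie on at most one
    ([meet]), so [line_sum] can be added up over [L]. *)
Lemma special_sum i :
  \sum_(v | (col v == i) && alive v) #|special v|%:R
  <= 4 * \sum_(v | (col v == i) && alive v)
           \sum_(j | (j != v) && alive j) corr S (f (p v)) (f (p j)) :> R.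
Proof.
pose A := [pred v | (col v == i) && alive v].
pose L := [set l | [exists v in A, [exists u, special v u && (l == pline v u)]]].
have LP l : l \in L -> exists v u, [/\ v \in A, special v u & l = pline v u].
  rewrite finset.in_set => /exists_inP[v vA /existsP[u /andP[vu /eqP ->]]].
  by exists v, u.
pose N (l : {set P}) v := #|[set u in l | (col u == i) && (u != v)]|.
pose C (l : {set P}) v :=
  \sum_(j in l | (j != v) && alive j) corr S (f (p v)) (f (p j)).
have cover v : v \in A -> (#|special v| <= \sum_(l in L | v \in l) N l v)%N.
  move=> vA; rewrite -sum1_card; under [leqRHS]eq_bigr do rewrite /N -sum1_card.
  rewrite (exchange_big_dep predT)//= big_mkcond/=; apply: leq_sum => u _.
  case: ifP => // vu; have vuL : pline v u \in L.
    rewrite finset.in_set; apply/exists_inP; exists v => //.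
    by apply/existsP; exists u; rewrite eqxx andbT.
  rewrite (bigD1 (pline v u)) ?leq_addr//= vuL pline_left finset.in_set pline_right.
  by case/and3P: vu => /eqP -> -> _; case/andP: vA => ->.
have meet v : v \in A -> \sum_(l in L | v \in l) C l v <=
    \sum_(j | (j != v) && alive j) corr S (f (p v)) (f (p j)).
  move=> vA; rewrite (exchange_big_dep (fun j => (j != v) && alive j))/=; last first.
    by move=> l j _ /and3P[_ -> ->].
  apply: ler_sum => j /andP[jv aj]; rewrite sumr_const.
  rewrite -[leRHS]mulr1n ler_wpMn2l// ?corr_ge0//.
  apply/card_le1_eqP => l l' /and3P[/andP[/LP[v1 [u1 [_ s1 ->]]] vl] jl _].
  move=> /and3P[/andP[/LP[v2 [u2 [_ s2 ->]]] vl'] jl' _].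
  have ne a b : special a b -> a != b by move=> /and3P[_ + _]; rewrite eq_sym.
  rewrite eq_sym in jv.
  by rewrite -(pline_eq (ne _ _ s1) jv vl jl) (pline_eq (ne _ _ s2) jv vl' jl').
apply: (@le_trans _ _ (\sum_(v in A) \sum_(l in L | v \in l) (N l v)%:R)).
  by apply: ler_sum => v vA; rewrite -natr_sum ler_nat cover.
apply: (@le_trans _ _ (4 * \sum_(v in A) \sum_(l in L | v \in l) C l v)); last first.
  by rewrite ler_pM2l//; apply: ler_sum => v /meet.
rewrite !(exchange_big_dep (mem L))/=; [|by move=> v l _ /andP[]..].
rewrite mulr_sumr; apply: ler_sum => l /[dup] lL /LP[v0 [u0 [/andP[/eqP c0 a0]]]].
move=> /and3P[_ + /exists_inP[w wl cw]] lE; rewrite eq_sym => vu0.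
have := line_sum vu0 a0 wl cw; rewrite /= -lE c0.
have reindex (F : P -> R) : \sum_(v in [set v in l | (col v == i) && alive v]) F v
    = \sum_(v in A | (l \in L) && (v \in l)) F v.
  by apply: eq_bigl => v; rewrite finset.in_set lL /= andbC.
by rewrite !reindex.
Qed.

End Lines.

(** * Dimension of the span *)

Lemma lker_subr_projv (K : fieldType) (vT : vectType K) (U : {vspace vT}) :
  lker (\1 - projv U)%VF = U.
Proof.
apply/vspaceP => x; rewrite memv_ker !lfun_simp subr_eq0.
apply/eqP/idP => [/= ->|/projv_id /= ->//]; exact: memv_proj.
Qed.

Section Span.
Variables (R : realType) (m n : nat) (P : finType) (p : P -> 'rV[R]_m) (col : P -> 'I_n).
Hypothesis p0 : forall x, p x != 0.
Hypothesis p_indep : forall x z, x != z -> p x \notin <[p z]>%VS.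

Let class_size x : nat := #|[pred u | col u == col x]|.

Lemma class_size_gt0 x : (0 < class_size x)%N.
Proof. by apply/card_gt0P; exists x; rewrite inE. Qed.

(** Each colour that occurs contributes exactly 1. *)
Lemma sum_inv_class_size : \sum_x (class_size x)%:R^-1 <= n%:R :> R.
Proof.
rewrite (partition_big col predT)//= -[n in leRHS]card_ord -sumr_const.
apply: ler_sum => i _; rewrite (eq_bigr (fun=> (#|[pred u | col u == i]|)%:R^-1)); last first.
  by move=> x /eqP ci; rewrite /class_size ci.
rewrite (eq_bigl [in [pred u | col u == i]])// sumr_const -[leLHS]mulr_natl.
set k := #|_|; by have [->|k0] := eqVneq k 0%N; rewrite ?mul0r// mulfV// pnatr_eq0.
Qed.

Let mass (U : {vspace 'rV[R]_m}) : R := \sum_(x | p x \in U) (class_size x)%:R^-1.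

(** Supplies the dimension hypothesis of [isotropic_form]. With [X] the span of [s], the space
    [X + U] is larger than [U], so maximality gives [lam * mass (X + U) < dim (X + U)]; subtracting
    [dim U <= lam * mass U] leaves the dimension of the image of [X]. *)
Lemma mass_quotient (lam : R) (U : {vspace 'rV[R]_m}) : 0 < lam ->
  (\dim U)%:R <= lam * mass U ->
  (forall W : {vspace 'rV[R]_m}, (\dim W)%:R <= lam * mass W -> (\dim W <= \dim U)%N) ->
  forall s : seq P, uniq s -> all (fun x => p x \notin U) s ->
  \sum_(x <- s) lam / (class_size x)%:R
    <= (\dim <<[seq (\1 - projv U)%VF (p x) | x <- s]>>)%:R.
Proof.
move=> lam0 dU maxU s us /allP sU; pose X := <<[seq p x | x <- s]>>%VS.
have -> : <<[seq (\1 - projv U)%VF (p x) | x <- s]>>%VS = ((\1 - projv U)%VF @: X)%VS.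
  by rewrite limg_span -map_comp.
have [s0|[x xs]] : s = [::] \/ exists x, x \in s.
  by case: (s) => [|x s']; [left|right; exists x; rewrite mem_head].
  by rewrite s0 big_nil.
have pX z : z \in s -> p z \in X by move=> zs; apply/memv_span/map_f.
have dimE := limg_ker_dim (\1 - projv U)%VF X; rewrite lker_subr_projv in dimE.
have dimW := dimv_sum_cap X U.
have dW : (\dim U < \dim (X + U))%N.
  rewrite (ltn_leqif (dimv_leqif_sup (addvSr X U))).
  apply: contra (sU x xs) => /subvP; apply; apply: (subvP (addvSl X U)); exact: pX.
have : lam * mass (X + U) < (\dim (X + U))%:R.
  by rewrite ltNge; apply: contraL dW => /maxU; rewrite leqNgt.
have : mass U + \sum_(x <- s) (class_size x)%:R^-1 <= mass (X + U).
  rewrite /mass [leRHS](bigID (fun x => p x \in U))/= lerD//.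
    rewrite le_eqVlt; apply/orP; left; apply/eqP/eq_bigl => z.
    by case zU: (p z \in U); rewrite ?andbF// (subvP (addvSr X U)).
  rewrite big_uniq//= big_mkcond [leRHS]big_mkcond/=; apply: ler_sum => z _.
  case: ifP => zs; last by case: ifP => // _; rewrite invr_ge0.
  by rewrite sU// (subvP (addvSl X U)) ?pX.
rewrite -mulr_sumr => h h2.
have -> : (\dim ((\1 - projv U)%VF @: X))%:R = (\dim (X + U))%:R - (\dim U)%:R :> R.
  apply/eqP; rewrite eq_sym subr_eq -natrD; apply/eqP; congr (_%:R).
  have arith a b c d e : (c + b = a -> e + c = a + d -> e = b + d)%N by lia.
  exact: arith dimE dimW.
move: dU h h2; move: (\sum_(_ <- _) _) (mass _) (mass _) => A B D; nra.
Qed.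

Theorem span_dim_le (delta : R) : 0 < delta ->
  (forall v, delta * (class_size v)%:R <= #|special p col v|%:R) ->
  (\dim <<[seq p x | x <- enum P]>>)%:R <= 17 / delta * n%:R.
Proof.
move=> delta0 MR; pose lam := 17 / delta.
have lam0 : 0 < lam by rewrite divr_gt0.
pose good k := `[< exists U : {vspace 'rV[R]_m}, \dim U = k /\ k%:R <= lam * mass U >].
have ex_good : exists k, good k.
  exists 0%N; apply/asboolP; exists 0%VS; rewrite dimv0; split=> //.
  by rewrite mulr_ge0 ?(ltW lam0)// sumr_ge0// => x _; rewrite invr_ge0.
have good_le k : good k -> (k <= m)%N.
  move=> /asboolP[U [<- _]].
  by rewrite (leq_trans (dimvS (subvf _)))// dimvf /dim/= mul1n.
have [k /asboolP[U [dimU dU]] maxk] := ex_maxnP ex_good good_le.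
have maxU (W : {vspace 'rV[R]_m}) : (\dim W)%:R <= lam * mass W -> (\dim W <= \dim U)%N.
  by move=> dW; rewrite dimU; apply: maxk; apply/asboolP; exists W.
have [allU|] := boolP [forall x, p x \in U].
  apply: (@le_trans _ _ k%:R).
    rewrite -dimU ler_nat; apply/dimvS/span_subvP => _ /mapP[x _ ->].
    exact: (forallP allU).
  apply: le_trans dU _; rewrite ler_pM2l//; apply: le_trans sum_inv_class_size.
  rewrite /mass big_mkcond; apply: ler_sum => x _.
  by case: ifP => // _; rewrite invr_ge0.
rewrite negb_forall => /existsP[x0 x0U]; exfalso; rewrite -dimU in dU.
pose f := (\1 - projv U)%VF.
have aliveE x : (f (p x) != 0) = (p x \notin U) by rewrite -memv_ker lker_subr_projv.
pose A := [pred x | p x \notin U].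
(* Points of [U] map to 0 and would violate the dimension hypothesis with their positive weights, so
   only the points of [A] are indexed. *)
have c_dim (s : seq 'I_#|A|) : uniq s ->
    \sum_(i <- s) lam / (class_size (enum_val i))%:R <=
    (\dim <<[seq f (p (enum_val i)) | i <- s]>>)%:R.
  move=> us; have := mass_quotient lam0 dU maxU (s := [seq enum_val i | i <- s]).
  rewrite map_inj_uniq// => [/(_ us)|]; last exact: enum_val_inj.
  rewrite big_map -map_comp; apply; apply/allP => _ /mapP[i _ ->].
  exact: (enum_valP i).
have c0 (i : 'I_#|A|) : 0 < lam / (class_size (enum_val i))%:R.
  by rewrite divr_gt0// ltr0n class_size_gt0.
have [S [pdS corrS]] := isotropic_form c0 c_dim.
have corr_le v : p v \notin U -> \sum_(j | p j \notin U)
    lam / (class_size j)%:R * corr S (f (p v)) (f (p j)) <= 4.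
  move=> vU; have := corrS (enum_rank_in (vU : v \in A) v).
  by rewrite enum_rankK_in// -(big_enum_val (A := A)
    (fun j => lam / (class_size j)%:R * corr S (f (p v)) (f (p j)))).
(* With the largest class among points outside [U], every weight there is at least [lam / k0], which
   turns the weighted bound 4 into a bound on the plain sum of correlations. *)
case: (arg_maxnP (P := A) class_size x0U) => v0 v0U maxv0.
set k0 := class_size v0 in maxv0; have k0pos : 0 < k0%:R :> R by rewrite ltr0n class_size_gt0.
pose B := [pred v | (col v == col v0) && (f (p v) != 0)].
have corr_sum v : v \in B ->
    \sum_(j | (j != v) && (f (p j) != 0)) corr S (f (p v)) (f (p j)) <= 4 * k0%:R / lam.
  move=> /andP[_]; rewrite aliveE => vU; rewrite ler_pdivlMr// mulrC -ler_pdivrMr//.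
  apply: le_trans (corr_le v vU); rewrite mulrAC mulr_sumr.
  rewrite big_mkcond [leRHS]big_mkcond; apply: ler_sum => j _; rewrite aliveE.
  have [jU|jU] := boolP (p j \in U); rewrite ?andbF//=.
  have cj : lam / k0%:R * corr S (f (p v)) (f (p j)) <=
      lam / (class_size j)%:R * corr S (f (p v)) (f (p j)).
    rewrite ler_wpM2r ?corr_ge0// ler_pM2l// lef_pV2 ?posrE ?ltr0n ?class_size_gt0//.
    by rewrite ler_nat; exact: maxv0.
  case: ifP => _; rewrite ?andbT//; apply: le_trans cj.
  by rewrite mulr_ge0 ?corr_ge0// divr_ge0// ltW.
have := special_sum p0 p_indep col f pdS (col v0).
(* Per point of [B], the left side is at least [delta * k0] and the right side at most
   [4 * 4 * k0 / lam = 16 / 17 * delta * k0]; any constant above 16 in [lam] would do. *)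
apply/negP; rewrite -ltNge.
apply: (@le_lt_trans _ _ (4 * \sum_(v in B) 4 * k0%:R / lam)).
  by rewrite ler_pM2l//; apply: ler_sum => v /corr_sum.
apply: (@lt_le_trans _ _ (\sum_(v in B) delta * k0%:R)); last first.
  apply: ler_sum => v /andP[/eqP cv _]; apply: le_trans (MR v).
  by rewrite /class_size cv.
rewrite !sumr_const -[X in _ * X]mulr_natl -[ltRHS]mulr_natl mulrCA ltr_pM2l; last first.
  rewrite ltr0n.
  by apply/card_gt0P; exists v0; rewrite inE eqxx aliveE.
rewrite /lam invf_div; have -> : 4 * (4 * k0%:R * (delta / 17)) = 16 / 17 * (delta * k0%:R).
  by field.
by rewrite gtr_pMl ?mulr_gt0//; lra.
Qed.

End Span.

(** * Affine configurations *)

Local Open Scope classical_set_scope.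
Local Open Scope ring_scope.

Section Homogeneous.
Variables (R : realType) (d : nat).
Implicit Types (v u w : 'rV[R]_d) (F : {fset 'rV[R]_d}).

Definition homog v : 'rV[R]_(1 + d) := row_mx 1%:M v.

Lemma homog_neq0 v : homog v != 0.
Proof.
apply/eqP => /(congr1 lsubmx); rewrite row_mxKl linear0 => /matrixP/(_ 0 0)/eqP.
by rewrite !mxE eqxx oner_eq0.
Qed.

Lemma homog_indep v u : v != u -> homog v \notin <[homog u]>%VS.
Proof.
apply: contra => /vlineP[a]; rewrite /homog scale_row_mx => /eq_row_mx[a1 ->].
move/matrixP/(_ 0 0): a1; rewrite !mxE eqxx mulr1 => <-.
by rewrite scale1r.
Qed.

Lemma homog_line v u w : line v u w -> homog w \in (<[homog v]> + <[homog u]>)%VS.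
Proof.
move=> [t _ <-]; have -> : homog (v + t *: (u - v)) = (1 - t) *: homog v + t *: homog u.
  rewrite /homog !scale_row_mx add_row_mx -scalerDl subrK scale1r; congr row_mx.
  by rewrite scalerBl scale1r scalerBr addrA addrAC.
by rewrite memv_add// memvZ// memv_line.
Qed.

Lemma affine_span_fset F v0 : v0 \in F ->
  affine_span [set` F] = translate v0 <<[seq v - v0 | v <- F]>>.
Proof.
move=> v0F; rewrite eqEsubset; split=> x.
  apply; split; first by right; exists v0, <<[seq v - v0 | v <- F]>>%VS.
  move=> v vF; exists (v - v0); last by rewrite addrC subrK.
  by apply/memv_span/(map_f (fun u => u - v0)).
move=> [u uX <-] A [[->|[q [U ->]]] FA]; first by have := FA v0 v0F.
have [a aU aE] := FA v0 v0F; exists (a + u); last by rewrite addrA aE.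
rewrite /= memvD//; apply: (subvP _ _ uX); apply/span_subvP => _ /mapP[v vF ->].
have [b bU <-] := FA v vF; rewrite -aE opprD addrACA subrr add0r.
exact: memvB.
Qed.

Lemma adim_le_homog F : (adim [set` F] <= \dim <<[seq homog v | v <- F]>>)%N.
Proof.
have [F0|[v0 v0F]] := fset_0Vmem F.
  (* The span of the empty set is empty, hence no translate, and [direction] takes its default value
     0. *)
  rewrite /adim /direction; case: xgetP => [U _ [q qE]|]; last by rewrite dimv0.
  have : affine_span [set` F] (q + 0) by rewrite qE; exists 0; rewrite //= mem0v.
  move=> /(_ set0)[]; split; first by left.
  by rewrite F0 => x.
rewrite /adim (affine_span_fset v0F) direction_translate.
(* The linear map sending [(s, v)] to [v - s * v0] takes [homog v] to [v - v0]. *)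
pose g := linfun (mulmxr (col_mx (- v0) 1%:M) : 'rV[R]_(1 + d) -> 'rV[R]_d).
have -> : [seq v - v0 | v <- F] = [seq g i | i <- [seq homog v | v <- F]].
  rewrite -map_comp; apply: eq_map => v.
  by rewrite /= lfunE /= mul_row_col mulmx1 mul1mx addrC.
rewrite -limg_span -(limg_ker_dim g <<[seq homog v | v <- F]>>).
exact: leq_addl.
Qed.

End Homogeneous.

Section ConfigurationDimension.
Variables (R : realType) (d n : nat) (V : 'I_n -> {fset 'rV[R]_d}).

Lemma mem_config x : reflect (exists i, x \in V i) (x \in config_points V).
Proof.
apply: (iffP (bigfcupP _ _ _ _)) => [[i _ xi]|[i xi]]; exists i => //.
by rewrite mem_enum.
Qed.

Lemma adim_config_le (delta : R) : 0 < delta -> mr_configuration delta V ->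
  (adim [set` config_points V])%:R <= 17 / delta * n%:R.
Proof.
move=> delta0 [disj _ MR]; set K := config_points V.
have VK i : (V i `<=` K)%fset by apply/fsubsetP => x xi; apply/mem_config; exists i.
have /choice[col colP] (x : K) : exists i, val x \in V i.
  exact/mem_config/valP.
have colE (x : K) i : (col x == i) = (val x \in V i).
  apply/eqP/idP => [<-//|xi]; apply/eqP; apply: contraT => /disj.
  by move=> /fdisjointP/(_ _ (colP x)); rewrite xi.
pose p (x : K) := homog (val x).
have p0 x : p x != 0 by exact: homog_neq0.
have p_indep x z : x != z -> p x \notin <[p z]>%VS.
  by move=> xz; apply: homog_indep; apply: contra xz => /eqP/val_inj ->.
have sizeE (x : K) : #|[pred u | col u == col x]| = #|` V (col x)|.
  rewrite -(card_fsub (VK (col x))); apply: eq_card => u.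
  by rewrite in_fsub inE colE.
apply: le_trans (span_dim_le p0 p_indep (col := col) delta0 _); last first.
  move=> x; rewrite sizeE; apply: le_trans (MR _ _ (colP x)) _; rewrite ler_nat.
  set Sp := (X in (#|` X| <= _)%N).
  have SpK : (Sp `<=` K)%fset.
    by apply/fsubsetP => u; rewrite !inE => /andP[/andP[_ /(fsubsetP (VK _))]].
  rewrite -(card_fsub SpK); apply: subset_leq_card; apply/fintype.subsetP => u.
  rewrite in_fsub !inE => /andP[/andP[ux uV] /asboolP[w]].
  rewrite in_fsetD => /andP[wV wK] wl; apply/and3P; split; first by rewrite colE.
    by apply: contra ux => /eqP ->.
  apply/exists_inP; exists [` wK]%fset; last by rewrite colE.
  by rewrite finset.in_set; exact: homog_line.
rewrite ler_nat; apply: leq_trans (adim_le_homog K) (dimvS _).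
apply/span_subvP => _ /mapP[v vK ->]; apply: memv_span.
by apply/mapP; exists [` vK]%fset; rewrite ?mem_enum.
Qed.

End ConfigurationDimension.

Theorem theorem1p4 (R : realType) :
  exists C : R, 0 < C /\
    forall (d n : nat) (delta eps : R) (V : 'I_n -> {fset 'rV[R]_d}),
      0 < delta ->
      mr_configuration delta V ->
      0 < eps -> eps < delta ->
      (adim [set` config_points V])%:R
        <= C / eps ^+ 2 * (1 + 1 / (delta - eps)) ^+ n.
Proof.
exists 17; split=> // d n delta eps V delta0 MR eps0 eps_delta.
have de0 : 0 < delta - eps by rewrite subr_gt0.
(* The bound [delta <= 1] comes from a point of the configuration, so the empty configuration is
   treated apart. *)
have [V0|[x /mem_config[i xi]]] := fset_0Vmem (config_points V).
  have := adim_le_homog (config_points V); rewrite V0 /= span_nil dimv0 leqn0 => /eqP ->.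
  by rewrite mulr_ge0// ?divr_ge0 ?sqr_ge0// exprn_ge0// addr_ge0// divr_ge0// ltW.
have delta1 : delta <= 1.
  have [_ _ /(_ i x xi)] := MR; set k := #|` V i|.
  have k0 : (0 < k)%N by rewrite cardfs_gt0; apply/fset0Pn; exists x.
  have : (#|` [fset u in (V i `\ x)%fset | `[< has_third_point V i x u >]]%fset| <= k)%N.
    by apply: fsubset_leq_card; apply/fsubsetP => u; rewrite !inE => /andP[/andP[]].
  rewrite -(ler_nat R) => /[swap] /le_trans/[apply].
  by rewrite -ler_pdivlMr ?ltr0n// divff// pnatr_eq0 -lt0n.
(* Now [eps^2 <= delta] because [eps < delta <= 1], and [n <= 2^n] is enough because
   [1 / (delta - eps) >= 1]. *)
apply: le_trans (adim_config_le delta0 MR) _.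
apply: ler_pM => //; first by rewrite divr_ge0// ltW.
  rewrite ler_pM2l// lef_pV2 ?posrE ?exprn_gt0//.
  by rewrite expr2; nra.
apply: (@le_trans _ _ (2 ^+ n)).
  by rewrite -natrX ler_nat ltnW// ltn_expl.
apply: lerXn2r; rewrite ?nnegrE// ?addr_ge0 ?divr_ge0 ?(ltW de0)//.
have : 1 <= 1 / (delta - eps) by rewrite ler_pdivlMr//; lra.
lra.
Qed.
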